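(* Let $\alpha,\beta,\gamma\in\mathbb{R}$ and let $G_3$ be the connected, simply connected three-dimensional Lie group with left-invariant Lorentzian metric $g$ whose Lie algebra has a pseudo-orthonormal basis $\{\widetilde e_1,\widetilde e_2,\widetilde e_3\}$, with $\widetilde e_3$ timelike, satisfying $$[\widetilde e_1,\widetilde e_2]=-\gamma\widetilde e_3,\quad [\widetilde e_1,\widetilde e_3]=-\beta\widetilde e_2,\quad [\widetilde e_2,\widetilde e_3]=\alpha\widetilde e_1.$$ Then the symmetrized Ricci tensor $\widetilde\rho^c$ of the canonical connection $\nabla^c$ is a Codazzi tensor on $(G_3,\nabla^c)$.
   Context: Basis vectors are identified with left-invariant vector fields on the group $G$; $g(\widetilde e_1,\widetilde e_1)=g(\widetilde e_2,\widetilde e_2)=1$, $g(\widetilde e_3,\widetilde e_3)=-1$, and $g(\widetilde e_i,\widetilde e_j)=0$ for $i\ne j$. Let $\nabla^L$ be the Levi-Civita connection of $g$ and $J$ the product structure on $G$ (a $(1,1)$ tensor field) with $J\widetilde e_1=\widetilde e_1$, $J\widetilde e_2=\widetilde e_2$, $J\widetilde e_3=-\widetilde e_3$. The canonical connection is $\nabla^c_XY=\nabla^L_XY-\tfrac12(\nabla^L_XJ)JY$, where $(\nabla^L_XJ)Y=\nabla^L_X(JY)-J\nabla^L_XY$. Curvature: $R^c(X,Y)Z=\nabla^c_X\nabla^c_YZ-\nabla^c_Y\nabla^c_XZ-\nabla^c_{[X,Y]}Z$. Ricci tensor: $\rho^c(X,Y)=-g(R^c(X,\widetilde e_1)Y,\widetilde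 e_1)-g(R^c(X,\widetilde e_2)Y,\widetilde e_2)+g(R^c(X,\widetilde e_3)Y,\widetilde e_3)$. Symmetrized Ricci tensor: $\widetilde\rho^c(X,Y)=\tfrac12(\rho^c(X,Y)+\rho^c(Y,X))$. For a linear connection $\nabla$ and a $(0,2)$ tensor field $\omega$: $(\nabla_X\omega)(Y,Z)=X[\omega(Y,Z)]-\omega(\nabla_XY,Z)-\omega(Y,\nabla_XZ)$. The tensor $\omega$ is called a Codazzi tensor on $(G,\nabla)$ if $(\nabla_X\omega)(Y,Z)-(\nabla_Y\omega)(X,Z)=0$ for all vector fields $X,Y,Z$. *)

(* Defs.v *)
From HB Require Import structures.
From mathcomp Require Import all_boot all_order all_algebra.
From mathcomp Require Import all_classical all_reals.
From mathcomp Require Import interval_inference topology normedtype landau derive.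
Set Implicit Arguments. Unset Strict Implicit. Unset Printing Implicit Defensive.
Import Order.TTheory GRing.Theory Num.Theory numFieldNormedType.Exports.
Local Open Scope classical_set_scope. Local Open Scope ring_scope.

Section Ck.
Context {R : realType}.

(* C^k regularity of f on an open set U: all iterated directional derivatives
   of order < k are Frechet differentiable on U, those of order k are
   continuous there.  Values of f outside U are irrelevant as U is open. *)
Fixpoint Ck {V W : normedModType R} (k : nat) (U : set V) (f : V -> W) : Prop :=
  if k is k'.+1 then
    (forall x, U x -> differentiable f x) /\ forall v : V, Ck k' U ('D_v f)
  else {in U, continuous f}.

Definition smooth_on {V W : normedModType R} (U : set V) (f : V -> W) : Prop :=
  forall k, Ck k U f.

Lemma near_eq_differentiable (V W : normedModType R) (f g : V -> W) x :
  (\near x, f x = g x) -> differentiable f x -> differentiable g x.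
Proof.
move=> fg df; have fgx : f x = g x := nbhs_singleton fg.
have {}fg : \forall h \near (0 : V), f (h + x) = g (h + x).
  by move: fg; rewrite (near_shift 0 x) subr0.
have gE : g \o shift x = cst (g x) + 'd f x +o_ 0 id.
  apply/eqaddoP => e e0; have /eqaddoP/(_ _ e0) := diff_locally df.
  by apply: filterS2 fg => h /=; rewrite !fctE /= fgx => ->.
have dgE : 'd g x = 'd f x :> (V -> W).
  by apply: diff_unique => //; exact: diff_continuous.
by apply/diff_locallyP; rewrite dgE; split => //; exact: diff_continuous.
Qed.

Lemma Ck_local (V W : normedModType R) k (U : set V) (f : V -> W) :
  (forall x, U x -> exists A : set V, [/\ open A, A x & Ck k A f]) -> Ck k U f.
Proof.
elim: k f => [|k IH] f /= loc.
  by move=> x /set_mem /loc [A [oA Ax Af]]; apply: Af; exact/mem_set.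
split=> [x /loc [A [_ Ax [df _]]]|v]; first exact: df.
by apply: IH => x /loc [A [oA Ax [_ Df]]]; exists A.
Qed.

Lemma eq_Ck (V W : normedModType R) k (U : set V) (f g : V -> W) : open U ->
  {in U, f =1 g} -> Ck k U f -> Ck k U g.
Proof.
move=> oU; elim: k f g => [|k IH] f g /= fg.
  move=> cf x xU; rewrite /prop_for /continuous_at -fg //.
  apply: cvg_trans (cf x xU); apply: near_eq_cvg.
  apply: filterS (open_nbhs_nbhs (conj oU (set_mem xU))) => y Uy.
  by rewrite fg //; exact: mem_set.
have fgn x : U x -> \near x, f x = g x.
  move=> Ux; apply: filterS (open_nbhs_nbhs (conj oU Ux)) => y Uy.
  exact/fg/mem_set.
case=> df Df; split=> [x Ux|v]; first exact: near_eq_differentiable (fgn x Ux) (df x Ux).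
apply: IH (Df v) => x /set_mem Ux; apply: near_eq_derive; exact: fgn.
Qed.

Lemma Ck_sub (V W : normedModType R) k (A B : set V) (f : V -> W) :
  A `<=` B -> Ck k B f -> Ck k A f.
Proof.
move=> AB; elim: k f => [|k IH] f /=.
  by move=> cf x /set_mem/AB/mem_set; exact: cf.
by case=> df Df; split=> [x /AB|v]; [exact: df|exact: IH].
Qed.

Lemma CkS (V W : normedModType R) k (U : set V) (f : V -> W) :
  Ck k.+1 U f -> Ck k U f.
Proof.
elim: k f => [|k IH] f /=.
  by case=> df _ x /set_mem Ux; apply: differentiable_continuous; exact: df.
by case=> df Df; split=> // v; apply: IH; exact: Df.
Qed.

Lemma Ck_cst (V W : normedModType R) k (U : set V) (w : W) :
  Ck k U (cst w : V -> W).
Proof.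
elim: k w => [|k IH] w /=; first by move=> x _; exact: cst_continuous.
split=> [x _|v]; first exact: differentiable_cst.
have -> : 'D_v (cst w) = cst 0 :> (V -> W) by apply/funext => x; rewrite derive_cst.
exact: IH.
Qed.

Lemma CkD (V W : normedModType R) k (U : set V) (f g : V -> W) :
  open U -> Ck k U f -> Ck k U g -> Ck k U (f + g).
Proof.
move=> oU; elim: k f g => [|k IH] f g /=.
  by move=> cf cg x Ux; exact: continuousD (cf x Ux) (cg x Ux).
move=> [df Df] [dg Dg]; split=> [x Ux|v].
  by apply: differentiableD; [exact: df|exact: dg].
apply: eq_Ck (IH _ _ (Df v) (Dg v)) => // x /set_mem Ux.
by rewrite deriveD //; apply: diff_derivable; [exact: df|exact: dg].
Qed.

Lemma CkM (V : normedModType R) k (U : set V) (f g : V -> R) :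
  open U -> Ck k U f -> Ck k U g -> Ck k U (f * g).
Proof.
move=> oU; elim: k f g => [|k IH] f g.
  by move=> cf cg x Ux; apply: continuousM; [exact: cf|exact: cg].
move=> /[dup] /CkS Cf [df Df] /[dup] /CkS Cg [dg Dg]; split=> [x Ux|v].
  by apply: differentiableM; [exact: df|exact: dg].
apply: (@eq_Ck _ _ _ _ (f * 'D_v g + g * 'D_v f)) => //; last first.
  by apply: CkD => //; apply: IH => //; [exact: Dg|exact: Df].
move=> x /set_mem Ux.
by rewrite deriveM //; apply: diff_derivable; [exact: df|exact: dg].
Qed.

Lemma Ck_sum (V W : normedModType R) k (U : set V) n (f : 'I_n -> V -> W) :
  open U -> (forall i, Ck k U (f i)) -> Ck k U (\sum_i f i).
Proof.
move=> oU Cf; elim/big_ind: _ => [|? ? ? ?|i _]; [exact: Ck_cst|exact: CkD|exact: Cf].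
Qed.

Lemma Ck_coord (V : normedModType R) n k (U : set V) (F : V -> 'rV[R]_n) i :
  open U -> Ck k U F -> Ck k U (fun x => F x 0 i).
Proof.
move=> oU; elim: k F => [|k IH] F /=.
  move=> cF x Ux; apply: (@continuous_comp _ _ _ F (fun M : 'rV_n => M 0 i)).
    exact: cF.
  exact: coord_continuous.
case=> dF DF; split=> [x Ux|v].
  apply: (@differentiable_comp _ _ _ _ F (fun M : 'rV_n => M 0 i)).
    exact: dF.
  exact: differentiable_coord.
apply: eq_Ck (IH _ (DF v)) => // x /set_mem Ux.
by rewrite derive_mx ?mxE //; exact/diff_derivable/dF.
Qed.

Lemma Ck_comp (V : normedModType R) n k (A : set V) (B : set 'rV[R]_n)
    (F : V -> 'rV[R]_n) (f : 'rV[R]_n -> R) :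
  open A -> open B -> A `<=` F @^-1` B -> Ck k A F -> Ck k B f ->
  Ck k A (f \o F).
Proof.
move=> oA oB AB; elim: k f => [|k IH] f.
  move=> cF cf x /set_mem Ax; apply: continuous_comp.
    exact/cF/mem_set.
  exact/cf/mem_set/AB.
move=> /[dup] /CkS CF [dF DF] [df Df]; split=> [x Ax|v].
  by apply: differentiable_comp; [exact: dF|exact/df/AB].
pose g i := (fun x => 'D_v F x 0 i) * ('D_(delta_mx 0 i) f \o F).
apply: (@eq_Ck _ _ _ _ (\sum_i g i)) => //; last first.
  apply: Ck_sum => // i; apply: CkM => //.
    by apply: Ck_coord => //; exact: DF.
  by apply: IH => //; exact: Df.
move=> x /set_mem Ax; have dfx := df _ (AB _ Ax); have dFx := dF _ Ax.
rewrite deriveE; last exact: differentiable_comp.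
rewrite diff_comp //= -(deriveE v dFx) fct_sumE [in RHS](row_sum_delta ('D_v F x)) linear_sum.
by apply: eq_bigr => i _; rewrite linearZ /= -deriveE.
Qed.

Lemma Ck_slice (V1 V2 W : normedModType R) k (A : set (V1 * V2)) (x : V1)
    (f : V1 * V2 -> W) :
  Ck k A f -> Ck k [set y | A (x, y)] (fun y => f (x, y)).
Proof.
have pd (y : V2) : is_diff y (pair x) (fun v => (0, v)).
  exact: (is_diff_pair (is_diff_cst x y) (is_diff_id y)).
elim: k f => [|k IH] f.
  move=> cf y /set_mem Axy; apply: (@continuous_comp _ _ _ (pair x) f).
    by apply: differentiable_continuous; have [] := pd y.
  exact/cf/mem_set.
case=> df Df; split=> [y Axy|v].
  by apply: (@differentiable_comp _ _ _ _ (pair x) f); [have [] := pd y|exact: df].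
have -> // : 'D_v (fun y => f (x, y)) = (fun y => 'D_(0, v) f (x, y)) :> (V2 -> W).
  apply/funext => y; rewrite /derive; congr (lim (_ @ 0^')); apply/funext => h /=.
  by rewrite -[h *: (0, v)]/(h *: 0, h *: v) scaler0 -[(0, _) + _]/(0 + x, _) add0r.
exact: IH (Df (0, v)).
Qed.

End Ck.

(* Only the values of chart_map on chart_dom, and of chart_inv on the image of
   chart_dom, are meaningful. *)
Record chart (R : realType) (n : nat) (M : topologicalType) := Chart {
  chart_dom : set M;
  chart_map :> M -> 'rV[R]_n;
  chart_inv : 'rV[R]_n -> M;
  open_chart_dom : open chart_dom;
  open_chart_img : open (chart_map @` chart_dom);
  chart_mapK : {in chart_dom, cancel chart_map chart_inv};
  chart_map_continuous : {in chart_dom, continuous chart_map};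
  chart_inv_continuous : {in chart_map @` chart_dom, continuous chart_inv} }.

Arguments open_chart_dom {R n M} c.
Arguments open_chart_img {R n M} c.

HB.mixin Record isSmoothManifold (R : realType) (n : nat) M of Topological M := {
  atlas : set (chart R n M);
  atlas_cover : forall p : M, exists2 c, atlas c & chart_dom c p;
  atlas_compat : forall c d : chart R n M, atlas c -> atlas d ->
    smooth_on (c @` (chart_dom c `&` chart_dom d)) (d \o chart_inv c);
  manifold_hausdorff : hausdorff_space M;
  manifold_second_countable : @second_countable M }.

(* Real, Hausdorff, second countable manifolds of dimension n; the atlas need
   not be maximal. *)
#[short(type="smoothManifoldType")]
HB.structure Definition SmoothManifold (R : realType) (n : nat) :=
  {M of isSmoothManifold R n M & Topological M}.

Section SmoothMaps.
Context {R : realType}.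

Definition smooth_map m n (M : smoothManifoldType R m) (N : smoothManifoldType R n)
    (F : M -> N) : Prop :=
  continuous F /\
  forall (c : chart R m M) (d : chart R n N), atlas c -> atlas d ->
    smooth_on (c @` (chart_dom c `&` F @^-1` chart_dom d)) (d \o F \o chart_inv c).

Definition smooth_fun n (M : smoothManifoldType R n) (f : M -> R) : Prop :=
  forall c : chart R n M, atlas c ->
    smooth_on (c @` chart_dom c) (f \o chart_inv c).
End SmoothMaps.

HB.mixin Record isLieGroup (R : realType) (n : nat) G
    of SmoothManifold R n G & Group G := {
  mulg_continuous : continuous (fun p : G * G => (p.1 * p.2)%g);
  mulg_smooth : forall c d e : chart R n G, atlas c -> atlas d -> atlas e ->
    smooth_on [set z : 'rV[R]_n * 'rV[R]_n |
        [/\ (c @` chart_dom c) z.1, (d @` chart_dom d) z.2 &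
            chart_dom e (chart_inv c z.1 * chart_inv d z.2)%g]]
      (fun z => e (chart_inv c z.1 * chart_inv d z.2)%g);
  invg_smooth : smooth_map (fun p : G => (p^-1)%g) }.

#[short(type="lieGroupType")]
HB.structure Definition LieGroup (R : realType) (n : nat) :=
  {G of isLieGroup R n G & SmoothManifold R n G & Group G}.

Section SmoothFunctions.
Context {R : realType} {n : nat} {M : smoothManifoldType R n}.

Definition smooth_pred : {pred M -> R} := mem [set f : M -> R | smooth_fun f].

Lemma smooth_pred_subring_closed : subring_closed smooth_pred.
Proof.
have sM f g : smooth_fun f -> smooth_fun g -> smooth_fun (f * g : M -> R).
  by move=> sf sg c Mc k; exact: (CkM (open_chart_img c) (sf c Mc k) (sg c Mc k)).
have s1 (a : R) : smooth_fun (cst a : M -> R) by move=> c Mc k; exact: Ck_cst.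
split=> [|f g|f g]; rewrite !inE; first exact: s1.
  move=> sf sg c Mc k; rewrite -[- g]mulN1r.
  exact: (CkD (open_chart_img c) (sf c Mc k) (sM _ _ (s1 (-1)) sg c Mc k)).
exact: sM.
Qed.

HB.instance Definition _ :=
  GRing.isSubringClosed.Build (M -> R) smooth_pred smooth_pred_subring_closed.

Lemma smooth_pred_scaler_closed : GRing.scaler_closed smooth_pred.
Proof.
move=> a f; rewrite !inE => sf c Mc k.
exact: (CkM (open_chart_img c) (Ck_cst _ _ a) (sf c Mc k)).
Qed.

HB.instance Definition _ :=
  GRing.isScaleClosed.Build R (M -> R) smooth_pred smooth_pred_scaler_closed.
End SmoothFunctions.

Record Cinfty (R : realType) (n : nat) (M : smoothManifoldType R n) := SmoothFun {
  Cinfty_fun :> M -> R;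
  Cinfty_smooth : Cinfty_fun \in smooth_pred }.

Section CinftyAlgebra.
Context {R : realType} {n : nat} {M : smoothManifoldType R n}.

HB.instance Definition _ := [isSub of Cinfty M for @Cinfty_fun R n M].
HB.instance Definition _ := [Choice of (Cinfty M) by <:].
HB.instance Definition _ := GRing.SubChoice_isSubComPzRing.Build _ _ (Cinfty M)
  (subringClosedP _).
HB.instance Definition _ := [SubZmodule_isSubLmodule of Cinfty M by <:].
End CinftyAlgebra.

Section VectorFields.
Context {R : realType} {n : nat} {M : smoothManifoldType R n}.

Lemma Cinfty_mulrZ (a : R) (f g : Cinfty M) : f * (a *: g) = a *: (f * g).
Proof. by apply/val_inj/funext => p; exact: mulrCA. Qed.

Definition derivation_at (p : M) : {pred Cinfty M -> R} :=
  mem [set v : Cinfty M -> R |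
    (forall (a : R) f g, v (a *: f + g) = a * v f + v g) /\
    (forall f g, v (f * g) = f p * v g + g p * v f)].

Lemma derivation_at_submod_closed p : GRing.submod_closed (derivation_at p).
Proof.
split=> [|b u v]; rewrite !inE.
  split=> [a f g|f g]; first by rewrite -[RHS]/(a * 0 + 0) mulr0 addr0.
  by rewrite -[RHS]/(f p * 0 + g p * 0) !mulr0 addr0.
move=> [lu mu] [lv mv].
have E h : (b *: u + v) h = b * u h + v h by [].
split=> [a f g|f g]; rewrite !E ?lu ?lv ?mu ?mv.
  by rewrite !mulrDr (mulrCA b) addrACA.
by rewrite !mulrDr ![b * (_ * _)]mulrCA addrACA.
Qed.

HB.instance Definition _ p :=
  GRing.isSubmodClosed.Build R (Cinfty M -> R) (derivation_at p)
    (derivation_at_submod_closed p).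

(* The codomain (Cinfty M)^o is C^oo(M) as a module over itself. *)
Definition derivation : {pred Cinfty M -> (Cinfty M)^o} :=
  mem [set X : Cinfty M -> (Cinfty M)^o |
    (forall (a : R) f g, X (a *: f + g) = a *: (X f : Cinfty M) + X g) /\
    (forall f g, X (f * g) = f * X g + g * X f)].

Lemma derivation_submod_closed : GRing.submod_closed derivation.
Proof.
split=> [|b u v]; rewrite !inE.
  split=> [a f g|f g].
    by rewrite -[RHS]/(a *: (0 : Cinfty M) + 0) scaler0 addr0.
  by rewrite -[RHS]/(f * 0 + g * 0) !mulr0 addr0.
move=> [lu mu] [lv mv].
have E h : (b *: u + v) h = b * u h + v h :> Cinfty M by [].
split=> [a f g|f g]; rewrite !E ?lu ?lv ?mu ?mv.
  by rewrite mulrDr Cinfty_mulrZ scalerDr addrACA.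
by rewrite !mulrDr ![b * (_ * _)]mulrCA addrACA.
Qed.

HB.instance Definition _ :=
  GRing.isSubmodClosed.Build (Cinfty M) (Cinfty M -> (Cinfty M)^o) derivation
    derivation_submod_closed.
End VectorFields.

(* T_pM as the space of derivations of C^oo(M) at p, and vector fields as
   derivations of C^oo(M); the latter form a C^oo(M)-module. *)
Record tangent (R : realType) (n : nat) (M : smoothManifoldType R n) (p : M) :=
  Tangent {
    tangent_fun :> Cinfty M -> R;
    tangentP : tangent_fun \in derivation_at p }.

Record vfield (R : realType) (n : nat) (M : smoothManifoldType R n) := VField {
  vfield_fun :> Cinfty M -> (Cinfty M)^o;
  vfieldP : vfield_fun \in derivation }.

Section Instances.
Context {R : realType} {n : nat} {M : smoothManifoldType R n}.

HB.instance Definition _ (p : M) := [isSub of tangent p for @tangent_fun R n M p].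
HB.instance Definition _ (p : M) := [Choice of tangent p by <:].
HB.instance Definition _ (p : M) := [SubChoice_isSubLmodule of tangent p by <:].

HB.instance Definition _ := [isSub of vfield M for @vfield_fun R n M].
HB.instance Definition _ := [Choice of vfield M by <:].
HB.instance Definition _ := [SubChoice_isSubLmodule of vfield M by <:].
End Instances.

Section Fields.
Context {R : realType} {n : nat} {M : smoothManifoldType R n}.
Implicit Types X Y Z : vfield M.

Lemma vector_at_subproof X p :
  (fun f => (X f : Cinfty M) p) \in derivation_at p.
Proof.
have [lX mX] := set_mem (vfieldP X).
by rewrite inE; split=> [a f g|f g]; rewrite ?lX ?mX.
Qed.

Definition vector_at X p : tangent p := Tangent (vector_at_subproof X p).

Lemma bracket_subproof X Y : (fun f => X (Y f) - Y (X f)) \in derivation.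
Proof.
have [lX mX] := set_mem (vfieldP X); have [lY mY] := set_mem (vfieldP Y).
have aX f g : X (f + g) = X f + X g by have := lX 1 f g; rewrite !scale1r.
have aY f g : Y (f + g) = Y f + Y g by have := lY 1 f g; rewrite !scale1r.
rewrite inE; split=> [a f g|f g].
  by rewrite lX lY lX lY scalerBr opprD addrACA.
have gen (x y u v p q : Cinfty M) :
    x + p + (y + q) - (u + q + (v + p)) = x - u + (y - v).
  rewrite addrACA (addrACA u) (addrC q) opprD [LHS]addrACA subrr addr0 opprD.
  exact: addrACA.
by rewrite mX mY aX aY !mX !mY (mulrC (X g)) (mulrC (X f) (Y g)) gen !mulrBr.
Qed.

Definition bracket X Y : vfield M := VField (bracket_subproof X Y).

Definition smooth_cst (k : R) : Cinfty M := k *: (1 : Cinfty M).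

Definition is_basis (K : pzRingType) (V : lmodType K) m (b : 'I_m -> V) : Prop :=
  forall v : V, exists! c : 'I_m -> K, v = \sum_i c i *: b i.
End Fields.

Section SmoothMapComp.
Context {R : realType}.

Lemma smooth_map_comp m n (M : smoothManifoldType R m) (N : smoothManifoldType R n)
    (F : M -> N) (f : N -> R) : smooth_map F -> smooth_fun f -> smooth_fun (f \o F).
Proof.
move=> [cF sF] sf c Mc k; apply: Ck_local => _ [p cp <-].
have [d Nd dFp] := atlas_cover (F p).
pose A := c @` (chart_dom c `&` F @^-1` chart_dom d).
have AE : A = c @` chart_dom c `&` chart_inv c @^-1` (F @^-1` chart_dom d).
  apply/seteqP; split=> [_ [q [cq dq] <-]|_ [[q cq <-] /=]].
    by split; [exists q|rewrite /= chart_mapK //; exact/mem_set].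
  by rewrite chart_mapK; [move=> dq; exists q|exact/mem_set].
have oA : open A.
  rewrite AE; move/(continuous_inP _ (open_chart_img c)): (@chart_inv_continuous _ _ _ c).
  by apply; move/continuousP: cF; apply; exact: open_chart_dom.
exists A; split=> //; first by exists p.
apply: (@eq_Ck _ _ _ _ _ ((f \o chart_inv d) \o (d \o F \o chart_inv c))) => //.
  move=> _ /set_mem [q [cq dq] <-] /=.
  by rewrite chart_mapK ?chart_mapK //; exact/mem_set.
apply: (Ck_comp oA (open_chart_img d)); last exact: sf.
  move=> _ [q [cq dq] <-]; exists (F q) => //=.
  by rewrite chart_mapK //; exact/mem_set.
exact: sF.
Qed.

Lemma smooth_map_mulgl n (G : lieGroupType R n) (a : G) :
  smooth_map (fun x : G => (a * x)%g).
Proof.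
split=> [x|c d Gc Gd k].
  apply: (@continuous_comp _ _ _ (pair a) (fun p : G * G => (p.1 * p.2)%g)).
    by apply: cvg_pair => //; exact: cvg_cst.
  exact: mulg_continuous.
have [b Gb ba] := atlas_cover a.
have := Ck_slice (b a) (mulg_smooth b c d Gb Gc Gd k).
rewrite /= chart_mapK; last exact/mem_set.
apply: Ck_sub => _ [q [cq dq] <-] /=; split; [by exists a|by exists q|].
by rewrite chart_mapK //; exact/mem_set.
Qed.
End SmoothMapComp.

Section LeftTranslations.
Context {R : realType} {n : nat} {G : lieGroupType R n}.

Lemma ltrans_pullback_subproof (a : G) (f : Cinfty G) :
  (fun x : G => f (a * x)%g) \in smooth_pred.
Proof.
by rewrite inE; apply: smooth_map_comp (smooth_map_mulgl a) _; exact: set_mem (Cinfty_smooth f).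
Qed.

Definition ltrans_pullback (a : G) (f : Cinfty G) : Cinfty G :=
  SmoothFun (ltrans_pullback_subproof a f).

Lemma dltrans_subproof (a p : G) (u : tangent p) :
  (fun f => u (ltrans_pullback a f)) \in derivation_at (a * p)%g.
Proof.
have [lu mu] := set_mem (tangentP u); rewrite inE; split=> [k f g|f g].
  by rewrite -lu; congr (u _); exact: val_inj.
by rewrite -[f _]/(ltrans_pullback a f p) -[g (_ * _)%g]/(ltrans_pullback a g p)
  -mu; congr (u _); exact: val_inj.
Qed.

(* The differential at p of the left translation x |-> a * x. *)
Definition dltrans (a p : G) (u : tangent p) : tangent (a * p)%g :=
  Tangent (dltrans_subproof a u).

Definition left_invariant (X : vfield G) : Prop :=
  forall a p : G, dltrans a (vector_at X p) = vector_at X (a * p)%g.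

(* The Lie algebra of G is T_1 G, a tangent vector at 1 being identified with
   the left-invariant vector field taking that value at 1. *)
Definition lie_basis m (e : 'I_m -> vfield G) : Prop :=
  (forall i, left_invariant (e i)) /\ is_basis (fun i => vector_at (e i) 1%g).
End LeftTranslations.

Record pseudoRiemannian (R : realType) (n : nat) (M : smoothManifoldType R n) :=
  PseudoRiemannian {
    metric_at : forall p : M, tangent p -> tangent p -> R;
    metric_sym : forall p (u v : tangent p), metric_at u v = metric_at v u;
    metric_linear : forall p (a : R) (u v w : tangent p),
      metric_at (a *: u + v) w = a * metric_at u w + metric_at v w;
    metric_nondegenerate : forall p (u : tangent p),
      (forall v, metric_at u v = 0) -> u = 0;
    metric_smooth : forall X Y : vfield M,
      (fun p => metric_at (vector_at X p) (vector_at Y p)) \in smooth_pred }.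

Section Geometry.
Context {R : realType} {n : nat} {M : smoothManifoldType R n}.
Implicit Types (g : pseudoRiemannian M) (X Y Z : vfield M)
  (nabla : vfield M -> vfield M -> vfield M)
  (w : vfield M -> vfield M -> Cinfty M).

Definition metric g X Y : Cinfty M := SmoothFun (metric_smooth g X Y).

(* Signature (n-1, 1): each tangent space has an orthonormal basis with exactly
   one timelike vector. *)
Definition lorentzian g : Prop :=
  forall p : M, exists (b : 'I_n -> tangent p) (k : 'I_n),
    is_basis b /\
    forall i j, metric_at g (b i) (b j) = (i == j)%:R * (-1) ^+ (i == k).

Definition is_connection nabla : Prop :=
  [/\ forall (f : Cinfty M) X Y Z, nabla (f *: X + Y) Z = f *: nabla X Z + nabla Y Z,
      forall X Y Z, nabla X (Y + Z) = nabla X Y + nabla X Z &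
      forall (f : Cinfty M) X Y, nabla X (f *: Y) = X f *: Y + f *: nabla X Y].

Definition levi_civita g nabla : Prop :=
  [/\ is_connection nabla,
      forall X Y, nabla X Y - nabla Y X = bracket X Y &
      forall X Y Z,
        X (metric g Y Z) = metric g (nabla X Y) Z + metric g Y (nabla X Z)].

(* (1,1) tensor fields are represented by C^oo(M)-linear endomorphisms of the
   module of vector fields. *)
Definition product_structure (J : vfield M -> vfield M) : Prop :=
  forall X, J (J X) = X.

Definition nabla_endo nabla (J : vfield M -> vfield M) X Y : vfield M :=
  nabla X (J Y) - J (nabla X Y).

Definition canonical_connection nabla (J : vfield M -> vfield M) X Y : vfield M :=
  nabla X Y - smooth_cst 2^-1 *: nabla_endo nabla J X (J Y).

Definition curvature nabla X Y Z : vfield M :=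
  nabla X (nabla Y Z) - nabla Y (nabla X Z) - nabla (bracket X Y) Z.

Definition covariant_derivative nabla w X Y Z : Cinfty M :=
  (X (w Y Z) : Cinfty M) - w (nabla X Y) Z - w Y (nabla X Z).

(* (0,2) tensor fields are identified with C^oo(M)-bilinear forms on vector
   fields. *)
Definition tensor02 w : Prop :=
  (forall (f : Cinfty M) X Y Z, w (f *: X + Y) Z = f * w X Z + w Y Z) /\
  (forall (f : Cinfty M) X Y Z, w X (f *: Y + Z) = f * w X Y + w X Z).

Definition codazzi nabla w : Prop :=
  tensor02 w /\
  forall X Y Z,
    covariant_derivative nabla w X Y Z - covariant_derivative nabla w Y X Z = 0.
End Geometry.

(* The sign convention and the roles of e1, e2 (spacelike) and e3 (timelike)
   are those of a pseudo-orthonormal frame of signature (+, +, -). *)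
Definition ricci (R : realType) (M : smoothManifoldType R 3)
    (g : pseudoRiemannian M) (nabla : vfield M -> vfield M -> vfield M)
    (e1 e2 e3 X Y : vfield M) : Cinfty M :=
  - metric g (curvature nabla X e1 Y) e1 - metric g (curvature nabla X e2 Y) e2
  + metric g (curvature nabla X e3 Y) e3.

Definition sym_ricci (R : realType) (M : smoothManifoldType R 3)
    (g : pseudoRiemannian M) (nabla : vfield M -> vfield M -> vfield M)
    (e1 e2 e3 X Y : vfield M) : Cinfty M :=
  2^-1 *: (ricci g nabla e1 e2 e3 X Y + ricci g nabla e1 e2 e3 Y X).

Definition left_invariant_metric (R : realType) (n : nat) (G : lieGroupType R n)
    (g : pseudoRiemannian G) : Prop :=
  forall (a p : G) (u v : tangent p),
    metric_at g (dltrans a u) (dltrans a v) = metric_at g u v.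

(* Every loop is contractible relative to its base point; connectedness is not
   included. *)
Definition simply_connected (R : realType) (T : topologicalType) : Prop :=
  forall c : R -> T, {within `[0, 1], continuous c} -> c 0 = c 1 ->
    exists H : R * R -> T,
      [/\ {within `[0, 1] `*` `[0, 1], continuous H},
          forall t, t \in `[0, 1] -> H (0, t) = c t,
          forall t, t \in `[0, 1] -> H (1, t) = c 0 &
          forall s, s \in `[0, 1] -> H (s, 0) = c 0 /\ H (s, 1) = c 0].

(* Main.v *)
Require Import Defs.
From mathcomp Require Import all_boot all_order all_algebra.
From mathcomp Require Import all_classical all_reals topology normedtype.
From mathcomp Require Import ring lra.
Import GRing.Theory.
Local Open Scope classical_set_scope.
Local Open Scope ring_scope.

(** The symmetrized Ricci tensor is even parallel for the canonical connection,
    so both terms of the Codazzi equation vanish.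

    The product structure J is self-adjoint for the metric, and the canonical
    connection is the average of the Levi-Civita connection and its conjugate
    by J ([canonical_connectionE]). Hence it preserves both the metric and J
    ([canonical_metric], [canonical_J]). Preserving the metric and the splitting
    into the plane of e1, e2 and the line of e3, it can only rotate the plane
    and must kill e3: for a 1-form phi, it sends e1 to phi(X) e2, e2 to
    - phi(X) e1 and e3 to 0 ([canonical_e1], [canonical_e2], [canonical_e3]).
    Such a connection has curvature dphi times the rotation generator.

    Koszul's formula gives phi(e1) = phi(e2) = 0 and
    phi(e3) = (alpha + beta - gamma) / 2, and the brackets then show that dphi
    vanishes on the frame except on (e1, e2), where it is the constant c = gamma phi(e3). So
    the Ricci form is - c times the metric of the plane, that is
    - c / 2 (g(X, Y) + g(X, JY)) ([ricci_canonical]). This is symmetric, and it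
    is parallel because g and J are ([canonical_parallel]).

    Passing from the frame to arbitrary vector fields uses that the frame spans
    the vector fields over the smooth functions ([orthonormal_expansion], by
    left translation to the identity) and that the Ricci form is a tensor
    ([ricci_tensor]). *)

(** * Functions, vector fields and their brackets *)

Section Algebra.
Set Implicit Arguments. Unset Strict Implicit. Unset Printing Implicit Defensive.
Context {R : realType} {n : nat} {M : smoothManifoldType R n}.
Implicit Types (f h : Cinfty M) (X Y Z : vfield M) (g : pseudoRiemannian M).

Lemma Cinfty_ext f h : (forall p, f p = h p) -> f = h.
Proof. by move=> E; apply/val_inj/funext. Qed.

Lemma vfield_ext X Y :
  (forall f p, (X f : Cinfty M) p = (Y f : Cinfty M) p) -> X = Y.
Proof. by move=> E; apply/val_inj/funext => f; apply: Cinfty_ext; exact: E. Qed.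

Lemma smooth_cstE (a : R) p : (smooth_cst a : Cinfty M) p = a.
Proof. exact: mulr1. Qed.

(** Evaluation at a point turns an identity between smooth functions, or
    between vector fields applied to a test function, into one between real
    numbers, where [ring] and [lra] apply. *)
Definition evalE := (
  (fun f h p => erefl : (f + h) p = f p + h p),
  (fun f p => erefl : (- f) p = - f p),
  (fun f h p => erefl : (f * h) p = f p * h p),
  (fun (a : R) f p => erefl : (a *: f) p = a * f p),
  (fun p => erefl : (1 : Cinfty M) p = 1),
  (fun p => erefl : (0 : Cinfty M) p = 0),
  smooth_cstE,
  (fun X Y f p => erefl : ((X + Y) f : Cinfty M) p
                          = (X f : Cinfty M) p + (Y f : Cinfty M) p),
  (fun X f p => erefl : ((- X) f : Cinfty M) p = - (X f : Cinfty M) p),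
  (fun f p => erefl : ((0 : vfield M) f : Cinfty M) p = 0),
  (fun h X f p => erefl : ((h *: X) f : Cinfty M) p = h p * (X f : Cinfty M) p)).

Lemma vfieldD X f h : X (f + h) = (X f : Cinfty M) + X h :> Cinfty M.
Proof.
by have [lX _] := set_mem (vfieldP X); have := lX 1 f h; rewrite !scale1r.
Qed.

Lemma vfieldM X f h : X (f * h) = f * X h + h * X f :> Cinfty M.
Proof. by have [_] := set_mem (vfieldP X). Qed.

Lemma vfield0 X : X 0 = 0 :> Cinfty M.
Proof. by apply: (addrI (X 0 : Cinfty M)); rewrite -vfieldD !addr0. Qed.

Lemma vfieldZ X (a : R) f : X (a *: f) = a *: (X f : Cinfty M) :> Cinfty M.
Proof.
by have [lX _] := set_mem (vfieldP X); have := lX a f 0; rewrite vfield0 !addr0.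
Qed.

Lemma vfield1 X : X 1 = 0 :> Cinfty M.
Proof.
apply: (addrI (X 1 : Cinfty M)).
by rewrite addr0 -[in RHS](mulr1 1) vfieldM !mul1r.
Qed.

Lemma vfield_cst X (a : R) : X (smooth_cst a) = 0 :> Cinfty M.
Proof. by rewrite vfieldZ vfield1 scaler0. Qed.

Lemma vfieldN X f : X (- f) = - (X f : Cinfty M) :> Cinfty M.
Proof. by rewrite -scaleN1r vfieldZ scaleN1r. Qed.

Lemma bracketDl X X' Y : bracket (X + X') Y = bracket X Y + bracket X' Y.
Proof.
apply: vfield_ext => f p; rewrite !evalE /= vfieldD !evalE; ring.
Qed.

Lemma bracketZl h X Y :
  bracket (h *: X) Y = h *: bracket X Y - (Y h : Cinfty M) *: X.
Proof.
apply: vfield_ext => f p.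
rewrite !evalE /= vfieldM !evalE; ring.
Qed.

Lemma bracket_anti X Y : bracket Y X = - bracket X Y.
Proof. by apply: vfield_ext => f p; rewrite !evalE /= opprB. Qed.

(** * Bilinear forms, the metric and connections *)

Section Tensor.
Context (w : vfield M -> vfield M -> Cinfty M).
Context (tw : tensor02 w).

Lemma tensorDl X Y Z : w (X + Y) Z = w X Z + w Y Z.
Proof. by have := tw.1 1 X Y Z; rewrite scale1r mul1r. Qed.
Lemma tensorDr X Y Z : w X (Y + Z) = w X Y + w X Z.
Proof. by have := tw.2 1 X Y Z; rewrite scale1r mul1r. Qed.
Lemma tensor0l Z : w 0 Z = 0.
Proof. by apply: (addrI (w 0 Z)); rewrite -tensorDl !addr0. Qed.
Lemma tensor0r Z : w Z 0 = 0.
Proof. by apply: (addrI (w Z 0)); rewrite -tensorDr !addr0. Qed.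
Lemma tensorZl f X Z : w (f *: X) Z = f * w X Z.
Proof. by have := tw.1 f X 0 Z; rewrite tensor0l !addr0. Qed.
Lemma tensorZr f X Z : w X (f *: Z) = f * w X Z.
Proof. by have := tw.2 f X Z 0; rewrite tensor0r !addr0. Qed.
Lemma tensorNl X Z : w (- X) Z = - w X Z.
Proof. by rewrite -scaleN1r tensorZl mulN1r. Qed.
Lemma tensorNr X Z : w X (- Z) = - w X Z.
Proof. by rewrite -scaleN1r tensorZr mulN1r. Qed.
End Tensor.

(** Both forms are bilinear over the smooth functions, and the coefficients of
    X and Y along the spanning fields are smooth functions. *)
Lemma eq_tensor_frame m (e : 'I_m -> vfield M) w w' :
  (forall X, exists c : 'I_m -> Cinfty M, X = \sum_i c i *: e i) ->
  tensor02 w -> tensor02 w' ->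
  (forall i j, w (e i) (e j) = w' (e i) (e j)) -> forall X Y, w X Y = w' X Y.
Proof.
move=> span tw tw' E X Y; have [c ->] := span X; have [d ->] := span Y.
have suml v : tensor02 v ->
    forall Z, v (\sum_i c i *: e i) Z = \sum_i c i * v (e i) Z.
  move=> tv Z; rewrite (big_morph _ (fun A B => tensorDl tv A B Z) (tensor0l tv Z)).
  by apply: eq_bigr => i _; rewrite (tensorZl tv).
have sumr v : tensor02 v ->
    forall Z, v Z (\sum_i d i *: e i) = \sum_i d i * v Z (e i).
  move=> tv Z; rewrite (big_morph _ (tensorDr tv Z) (tensor0r tv Z)).
  by apply: eq_bigr => i _; rewrite (tensorZr tv).
rewrite !suml //; apply: eq_bigr => i _; rewrite !sumr //.
by congr (_ * _); apply: eq_bigr => j _; rewrite E.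
Qed.

Lemma metricC g X Y : metric g X Y = metric g Y X.
Proof. by apply: Cinfty_ext => p; exact: Defs.metric_sym. Qed.

Lemma metric_tensor g : tensor02 (metric g).
Proof.
have lin f X Y Z : metric g (f *: X + Y) Z = f * metric g X Z + metric g Y Z.
  apply: Cinfty_ext => p; rewrite !evalE -metric_linear /=; congr metric_at.
  exact: val_inj.
by split=> // f X Y Z; rewrite metricC lin !(metricC g X).
Qed.

Section Metric.
Context (g : pseudoRiemannian M).
Definition metricDl := tensorDl (metric_tensor g).
Definition metricDr := tensorDr (metric_tensor g).
Definition metricNl := tensorNl (metric_tensor g).
Definition metricNr := tensorNr (metric_tensor g).
Definition metricZl := tensorZl (metric_tensor g).
Definition metricZr := tensorZr (metric_tensor g).
End Metric.

Section Connection.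
Context (D : vfield M -> vfield M -> vfield M).
Context (cD : is_connection D).

Lemma connDl X Y Z : D (X + Y) Z = D X Z + D Y Z.
Proof. by case: cD => l _ _; have := l 1 X Y Z; rewrite !scale1r. Qed.
Lemma conn0l Z : D 0 Z = 0.
Proof. by apply: (addrI (D 0 Z)); rewrite -connDl !addr0. Qed.
Lemma connZl f X Z : D (f *: X) Z = f *: D X Z.
Proof. by case: cD => l _ _; have := l f X 0 Z; rewrite conn0l !addr0. Qed.
Lemma connNl X Z : D (- X) Z = - D X Z.
Proof. by rewrite -scaleN1r connZl scaleN1r. Qed.
Lemma connDr X Y Z : D X (Y + Z) = D X Y + D X Z.
Proof. by case: cD. Qed.
Lemma connZr f X Z : D X (f *: Z) = (X f : Cinfty M) *: Z + f *: D X Z.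
Proof. by case: cD. Qed.
Lemma conn0r X : D X 0 = 0.
Proof. by apply: (addrI (D X 0)); rewrite -connDr !addr0. Qed.

(** The derivatives of f produced by the Leibniz rule for [D Y] and by the
    bracket cancel; together with the next lemma this makes the Ricci form a
    tensor, hence determined by its values on a frame. *)
Lemma curvature_linear1 f X X' Y Z :
  curvature D (f *: X + X') Y Z = f *: curvature D X Y Z + curvature D X' Y Z.
Proof.
rewrite /curvature bracketDl bracketZl !connDl connNl !connZl connDr connZr.
apply: vfield_ext => h p; rewrite !evalE; ring.
Qed.

Lemma curvature_linear3 f X Y Z Z' :
  curvature D X Y (f *: Z + Z') = f *: curvature D X Y Z + curvature D X Y Z'.
Proof.
rewrite /curvature !(connDr, connZr).
apply: vfield_ext => h p; rewrite !evalE; ring.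
Qed.
End Connection.
End Algebra.

Lemma ricci_tensor (R : realType) (M : smoothManifoldType R 3)
    (g : pseudoRiemannian M) D e1 e2 e3 :
  is_connection D -> tensor02 (ricci g D e1 e2 e3).
Proof.
move=> cD; split=> f X Y Z; rewrite /ricci.
  rewrite 3!(curvature_linear1 cD) 3!(metric_tensor g).1.
  apply: Cinfty_ext => p; rewrite !evalE; ring.
rewrite 3!(curvature_linear3 cD) 3!(metric_tensor g).1.
apply: Cinfty_ext => p; rewrite !evalE; ring.
Qed.

(** * Expansion along a left-invariant orthonormal frame *)

Section Frame.
Set Implicit Arguments. Unset Strict Implicit. Unset Printing Implicit Defensive.
Context {R : realType} {n : nat} {G : lieGroupType R n}.

Lemma tangent_sumE (p : G) m (u : 'I_m -> tangent p) f :
  (\sum_i u i) f = \sum_i u i f.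
Proof. exact: (big_morph (fun v : tangent p => v f) (fun _ _ => erefl) erefl). Qed.

Lemma vfield_sumE m (X : 'I_m -> vfield G) f (p : G) :
  ((\sum_i X i) f : Cinfty G) p = \sum_i (X i f : Cinfty G) p.
Proof.
exact: (big_morph (fun Y : vfield G => (Y f : Cinfty G) p) (fun _ _ => erefl) erefl).
Qed.

(** Left translation by the inverse of p carries v to the identity, where the
    frame is a basis, and the coefficients found there serve at p because the
    frame is left-invariant. *)
Lemma lie_basis_span m (e : 'I_m -> vfield G) (p : G) (v : tangent p) :
  lie_basis e -> exists c : 'I_m -> R, v = \sum_i c i *: vector_at (e i) p.
Proof.
case=> inv basis.
have at1 q (w : tangent q) : q = 1%g -> exists c : 'I_m -> R,
    forall f, w f = \sum_i c i * (e i f : Cinfty G) q.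
  (* The translated vector lives at p^-1 * p, which is only propositionally
     the identity, so q is replaced by 1 before the basis is used. *)
  move=> q1; case: _ / (esym q1) w => w; have [c [wE _]] := basis w.
  by exists c => f; rewrite {1}wE tangent_sumE.
have [c cE] := at1 _ (dltrans (p^-1)%g v) (mulVg p).
exists c; apply/val_inj/funext => f /=; rewrite tangent_sumE.
have -> : v f = dltrans (p^-1)%g v (ltrans_pullback p f).
  by congr (v _); apply: Cinfty_ext => x /=; rewrite mulVKg.
rewrite cE; apply: eq_bigr => i _; congr (_ * _).
have /(congr1 (fun u => tangent_fun u f)) := inv i p (p^-1 * p)%g.
by rewrite /= => ->; rewrite mulVKg.
Qed.

(** The expansion holds at each point by the preceding lemma; orthonormality
    identifies the coefficients, which shows that they are smooth. *)
Lemma orthonormal_expansion (g : pseudoRiemannian G) m (e : 'I_m -> vfield G)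
    (eps : 'I_m -> R) (X : vfield G) :
  lie_basis e -> (forall i, eps i * eps i = 1) ->
  (forall i j, metric g (e i) (e j) = smooth_cst (eps i *+ (i == j))) ->
  X = \sum_i (eps i *: metric g X (e i)) *: e i.
Proof.
move=> eB eps2 eO; apply: vfield_ext => f p; rewrite vfield_sumE.
have [c cE] := lie_basis_span (vector_at X p) eB.
have gE i : metric g X (e i) p = eps i * c i.
  have pl Y : metric_at g 0 (vector_at Y p) = 0.
    have := metric_linear g 1 0 0 (vector_at Y p).
    by rewrite scale1r addr0 mul1r -[LHS]addr0 => /addrI.
  have pD Y u v : metric_at g (u + v) (vector_at Y p) =
      metric_at g u (vector_at Y p) + metric_at g v (vector_at Y p).
    by have := metric_linear g 1 u v (vector_at Y p); rewrite scale1r mul1r.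
  rewrite /= cE (big_morph _ (pD _) (pl _)) (bigD1 i) //= big1 => [|j ji].
    rewrite addr0 -[c i *: _]addr0 metric_linear pl addr0.
    by rewrite -[metric_at _ _ _]/(metric g (e i) (e i) p) eO eqxx smooth_cstE mulrC.
  rewrite -[c j *: _]addr0 metric_linear pl addr0.
  rewrite -[metric_at _ _ _]/(metric g (e j) (e i) p) eO.
  by rewrite (negbTE ji) smooth_cstE mulr0.
rewrite -[LHS]/(vector_at X p f) cE tangent_sumE; apply: eq_bigr => i _.
by rewrite !evalE gE mulrA eps2 mul1r.
Qed.
End Frame.

(** * The canonical connection of an isometric product structure *)

Section CanonicalConnection.
Set Implicit Arguments. Unset Strict Implicit. Unset Printing Implicit Defensive.
Context {R : realType} {n : nat} {M : smoothManifoldType R n}.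
Implicit Types (f h : Cinfty M) (X Y Z : vfield M).
Context (g : pseudoRiemannian M) (D : vfield M -> vfield M -> vfield M).
Context (lc : levi_civita g D).

(** Koszul's formula: the metric is parallel and the torsion vanishes, so
    brackets and derivatives of the metric determine the connection. *)
Lemma koszul X Y Z :
  smooth_cst 2 * metric g (D X Y) Z =
  (X (metric g Y Z) : Cinfty M) + (Y (metric g X Z) : Cinfty M)
  - (Z (metric g X Y) : Cinfty M)
  + metric g (bracket X Y) Z - metric g (bracket X Z) Y
  - metric g (bracket Y Z) X.
Proof.
have [_ tor com] := lc; rewrite -!tor !com !metricDl !metricNl.
rewrite (metricC g Y (D X Z)) (metricC g X (D Y Z)) (metricC g X (D Z Y)).
apply: Cinfty_ext => p; rewrite !evalE; ring.
Qed.

Context (J : {linear vfield M -> vfield M}).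
Context (JJ : product_structure J)
  (Jg : forall X Y, metric g (J X) Y = metric g X (J Y)).

Let C := canonical_connection D J.

(** The canonical connection is the average of the given connection and its
    conjugate by J; its properties are read off this form. *)
Lemma canonical_connectionE X Y :
  C X Y = smooth_cst 2^-1 *: (D X Y + J (D X (J Y))).
Proof.
rewrite /C /canonical_connection /nabla_endo JJ.
apply: vfield_ext => f p; rewrite !evalE; lra.
Qed.

Let JD Y Z : J (Y + Z) = J Y + J Z := linearD J Y Z.
Let JZ f Y : J (f *: Y) = f *: J Y := linearZZ J f Y.

Lemma canonical_is_connection : is_connection C.
Proof.
have [cD _ _] := lc.
split=> [f X Y Z|X Y Z|f X Y]; rewrite !canonical_connectionE.
- rewrite !(connDl cD, connZl cD) JD JZ.
  by apply: vfield_ext => h p; rewrite !evalE; ring.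
- by rewrite JD !(connDr cD) JD addrACA scalerDr.
rewrite JZ !(connZr cD) JD !JZ JJ.
by apply: vfield_ext => h p; rewrite !evalE /=; lra.
Qed.

Lemma canonical_J X Y : C X (J Y) = J (C X Y).
Proof. by rewrite !canonical_connectionE JZ JD !JJ addrC. Qed.

(** Conjugating a metric connection by the isometry J gives a metric
    connection, and so does averaging. *)
Lemma canonical_metric X Y Z :
  X (metric g Y Z) = metric g (C X Y) Z + metric g Y (C X Z) :> Cinfty M.
Proof.
have [_ _ com] := lc.
have JJg : metric g (J Y) (J Z) = metric g Y Z by rewrite Jg JJ.
rewrite !canonical_connectionE metricZl metricZr metricDl metricDr.
rewrite (Jg _ Z) -(Jg Y).
have E1 := com X Y Z; have E2 := com X (J Y) (J Z).
rewrite JJg E1 in E2; rewrite E1.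
apply: Cinfty_ext => p; have := congr1 (fun f : Cinfty M => f p) E2.
rewrite !evalE; lra.
Qed.

(** Both the metric and J are parallel for the canonical connection, hence so
    is every constant combination of g(Y, Z) and g(Y, JZ). *)
Lemma canonical_parallel (k : R) X Y Z :
  covariant_derivative C (fun Y Z => k *: (metric g Y Z + metric g Y (J Z)))
    X Y Z = 0.
Proof.
rewrite /covariant_derivative vfieldZ vfieldD !canonical_metric canonical_J.
apply: Cinfty_ext => p; rewrite !evalE; ring.
Qed.
End CanonicalConnection.

(** * Curvature of a connection that rotates a plane *)

Section PlaneRotation.
Set Implicit Arguments. Unset Strict Implicit. Unset Printing Implicit Defensive.
Context {R : realType} {n : nat} {M : smoothManifoldType R n}.
Context {D : vfield M -> vfield M -> vfield M} {phi : vfield M -> Cinfty M}.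
Context {e1 e2 e3 : vfield M}.
Context (cD : is_connection D).
Context (De1 : forall X, D X e1 = phi X *: e2).
Context (De2 : forall X, D X e2 = - phi X *: e1).
Context (De3 : forall X, D X e3 = 0).

(** The exterior derivative of the connection form [phi]. As rotations of a
    fixed plane commute, it is the whole curvature. *)
Definition dform (X Y : vfield M) : Cinfty M :=
  (X (phi Y) : Cinfty M) - Y (phi X) - phi (bracket X Y).

Lemma curvature_plane1 X Y : curvature D X Y e1 = dform X Y *: e2.
Proof.
rewrite /curvature /dform !De1 !(connZr cD) !De2 !scalerA !mulrN.
by rewrite (mulrC (phi Y)) opprD addrACA subrr addr0 -!scalerBl.
Qed.

Lemma curvature_plane2 X Y : curvature D X Y e2 = - dform X Y *: e1.
Proof.
rewrite /curvature /dform !De2 !(connZr cD) !De1 !vfieldN !scalerA !mulNr.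
by rewrite (mulrC (phi Y)) opprD addrACA subrr addr0 -!scalerBl !opprD.
Qed.

Lemma curvature_axis X Y : curvature D X Y e3 = 0.
Proof. by rewrite /curvature !De3 !(conn0r cD) !subr0. Qed.
End PlaneRotation.

(** * The three-dimensional Lie group *)

Section Frame3.
Set Implicit Arguments. Unset Strict Implicit. Unset Printing Implicit Defensive.

Lemma I3_ind (P : 'I_3 -> Prop) : P 0 -> P 1 -> P 2 -> forall i, P i.
Proof.
move=> P0 P1 P2 [[|[|[|//]]] i3].
- by have -> : Ordinal i3 = 0 by exact: val_inj.
- by have -> : Ordinal i3 = 1 by exact: val_inj.
by have -> : Ordinal i3 = 2 by exact: val_inj.
Qed.

Context {R : realType} {alpha beta gamma : R} {G : lieGroupType R 3}.
Context {g : pseudoRiemannian G} {e1 e2 e3 : vfield G}.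
Context {D : vfield G -> vfield G -> vfield G} {J : {linear vfield G -> vfield G}}.
Context (eB : lie_basis (tnth [tuple e1; e2; e3])).
Context (g11 : metric g e1 e1 = 1) (g22 : metric g e2 e2 = 1)
    (g33 : metric g e3 e3 = -1)
    (g12 : metric g e1 e2 = 0) (g13 : metric g e1 e3 = 0)
    (g23 : metric g e2 e3 = 0).
Context (br12 : bracket e1 e2 = smooth_cst (- gamma) *: e3)
    (br13 : bracket e1 e3 = smooth_cst (- beta) *: e2)
    (br23 : bracket e2 e3 = smooth_cst alpha *: e1).
Context (lc : levi_civita g D).
Context (JJ : product_structure J)
    (Je1 : J e1 = e1) (Je2 : J e2 = e2) (Je3 : J e3 = - e3).

Let g21 : metric g e2 e1 = 0. Proof. by rewrite metricC. Qed.
Let g31 : metric g e3 e1 = 0. Proof. by rewrite metricC. Qed.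
Let g32 : metric g e3 e2 = 0. Proof. by rewrite metricC. Qed.
Let gE := (g11, g22, g33, g12, g13, g23, g21, g31, g32).

Lemma frame_expansion X :
  X = metric g X e1 *: e1 + metric g X e2 *: e2 - metric g X e3 *: e3.
Proof.
pose eps : 'I_3 -> R := tnth [tuple 1; 1; -1].
have eps2 : forall i, eps i * eps i = 1.
  by apply: I3_ind; rewrite /eps !(tnth_nth 0) /= ?mulrNN mulr1.
have eO : forall i j,
    metric g (tnth [tuple e1; e2; e3] i) (tnth [tuple e1; e2; e3] j)
    = smooth_cst (eps i *+ (i == j)).
  apply: I3_ind; apply: I3_ind; rewrite /eps !(tnth_nth 0) /= gE;
    by apply: Cinfty_ext => p; rewrite !evalE.
rewrite {1}(orthonormal_expansion X eB eps2 eO) !big_ord_recl big_ord0 /eps.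
by rewrite !(tnth_nth 0) /= addr0 !scale1r scaleN1r scaleNr addrA.
Qed.

Lemma eq_tensor_frame3 w w' : tensor02 w -> tensor02 w' ->
  (forall i j, w (tnth [tuple e1; e2; e3] i) (tnth [tuple e1; e2; e3] j)
    = w' (tnth [tuple e1; e2; e3] i) (tnth [tuple e1; e2; e3] j)) ->
  forall X Y, w X Y = w' X Y.
Proof.
apply: eq_tensor_frame => X.
exists (tnth [tuple metric g X e1; metric g X e2; - metric g X e3]).
rewrite !big_ord_recl big_ord0 !(tnth_nth 0) /= addr0 addrA scaleNr.
exact: frame_expansion.
Qed.

Let JD Y Z : J (Y + Z) = J Y + J Z := linearD J Y Z.
Let JZ f Y : J (f *: Y) = f *: J Y := linearZZ J f Y.

(** By bilinearity the frame suffices: it is orthogonal and diagonalizes J. *)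
Lemma J_selfadjoint X Y : metric g (J X) Y = metric g X (J Y).
Proof.
apply: (@eq_tensor_frame3
  (fun X Y => metric g (J X) Y) (fun X Y => metric g X (J Y))).
- by split=> f A B C; rewrite ?JD ?JZ ?metricDl ?metricDr ?metricZl ?metricZr.
- by split=> f A B C; rewrite ?JD ?JZ ?metricDl ?metricDr ?metricZl ?metricZr.
by apply: I3_ind; apply: I3_ind; rewrite !(tnth_nth 0) /= ?Je1 ?Je2 ?Je3
   ?metricNl ?metricNr ?gE ?oppr0.
Qed.

Lemma parallel_form_tensor (k : R) :
  tensor02 (fun X Y => k *: (metric g X Y + metric g X (J Y))).
Proof.
split=> f X Y Z.
  rewrite !metricDl !metricZl.
  by apply: Cinfty_ext => p; rewrite !evalE; ring.
rewrite JD JZ !metricDr !metricZr.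
by apply: Cinfty_ext => p; rewrite !evalE; ring.
Qed.

Let C := canonical_connection D J.
Let cC : is_connection C := canonical_is_connection lc JJ.
Let CJ X Y : C X (J Y) = J (C X Y) := canonical_J D JJ X Y.
Let Cg (X Y Z : vfield G) :
  X (metric g Y Z) = metric g (C X Y) Z + metric g Y (C X Z) :> Cinfty G :=
  canonical_metric lc JJ J_selfadjoint X Y Z.

(** The canonical connection preserves the metric and the splitting into the
    eigenspaces of J, so it acts on e1, e2 by an infinitesimal rotation, of
    which this is the angular speed, and it kills the unit field e3. *)
Definition rotation_form X : Cinfty G := metric g (C X e1) e2.

Lemma Cinfty_double_eq0 (f : Cinfty G) : f + f = 0 -> f = 0.
Proof.
move=> f0; apply: Cinfty_ext => p; have := congr1 (fun h : Cinfty G => h p) f0.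
by rewrite !evalE; lra.
Qed.

(** A field of constant length is orthogonal to its derivatives. *)
Let unit_self X Y (a : R) : metric g Y Y = smooth_cst a -> metric g (C X Y) Y = 0.
Proof.
move=> YY; apply: Cinfty_double_eq0.
by rewrite {2}metricC -Cg YY vfield_cst.
Qed.

Let unit1 X : metric g (C X e1) e1 = 0.
Proof. by apply: (@unit_self X e1 1); rewrite g11 /smooth_cst scale1r. Qed.
Let unit2 X : metric g (C X e2) e2 = 0.
Proof. by apply: (@unit_self X e2 1); rewrite g22 /smooth_cst scale1r. Qed.
Let unit3 X : metric g (C X e3) e3 = 0.
Proof. by apply: (@unit_self X e3 (-1)); rewrite g33 /smooth_cst scaleN1r. Qed.

(** The +1-eigenspace of J is parallel, and e3 is orthogonal to it. *)
Let perp3 X Y : J Y = Y -> metric g (C X Y) e3 = 0.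
Proof.
move=> JY; apply: Cinfty_double_eq0.
by rewrite -{2}JY CJ J_selfadjoint Je3 metricNr subrr.
Qed.

Let skew X Y Z : metric g Y Z = 0 -> metric g (C X Z) Y = - metric g (C X Y) Z.
Proof.
move=> YZ; apply/eqP; rewrite -addr_eq0 metricC addrC -Cg YZ.
by rewrite vfield0.
Qed.

Lemma canonical_e1 X : C X e1 = rotation_form X *: e2.
Proof.
by rewrite [LHS]frame_expansion unit1 (perp3 _ Je1) !scale0r add0r subr0.
Qed.

Lemma canonical_e2 X : C X e2 = - rotation_form X *: e1.
Proof.
by rewrite [LHS]frame_expansion unit2 (perp3 _ Je2) !scale0r addr0 subr0
  (skew _ g12).
Qed.

Lemma canonical_e3 X : C X e3 = 0.
Proof.
rewrite [LHS]frame_expansion unit3 (skew _ g13) (skew _ g23).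
by rewrite (perp3 _ Je1) (perp3 _ Je2) !(oppr0, scale0r, addr0).
Qed.

(** On the +1-eigenspace of J the canonical connection is the orthogonal
    projection of the Levi-Civita connection, to which Koszul's formula
    applies. *)
Lemma rotation_formE X : rotation_form X = metric g (D X e1) e2.
Proof.
rewrite /rotation_form /C (canonical_connectionE _ JJ) metricZl metricDl.
rewrite J_selfadjoint Je1 Je2.
by apply: Cinfty_ext => p; rewrite !evalE; lra.
Qed.

Let bracket_self (X : vfield G) : bracket X X = 0.
Proof. by apply: vfield_ext => f p; exact: subrr. Qed.

Let br21 : bracket e2 e1 = smooth_cst gamma *: e3.
Proof. by rewrite bracket_anti br12 /smooth_cst scaleNr scaleNr opprK. Qed.
Let br31 : bracket e3 e1 = smooth_cst beta *: e2.
Proof. by rewrite bracket_anti br13 /smooth_cst scaleNr scaleNr opprK. Qed.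
Let br32 : bracket e3 e2 = smooth_cst (- alpha) *: e1.
Proof. by rewrite bracket_anti br23 /smooth_cst scaleNr scaleNr. Qed.
Let brE := (bracket_self, br12, br13, br23, br21, br31, br32).

(** All derivatives in Koszul's formula vanish on the frame, as the metric is
    constant there; only the brackets remain. *)
Let koszul_e1e2 (X : vfield G) (a : R) :
  (X = e1 \/ X = e2 \/ X = e3) ->
  metric g (bracket X e1) e2 - metric g (bracket X e2) e1
    - metric g (bracket e1 e2) X
    = smooth_cst (2 * a) -> rotation_form X = smooth_cst a.
Proof.
have d1 : metric g e1 e1 = smooth_cst 1 by rewrite g11 /smooth_cst scale1r.
have d2 : metric g e2 e2 = smooth_cst 1 by rewrite g22 /smooth_cst scale1r.
move=> Xe E; rewrite rotation_formE.
have := koszul lc X e1 e2; rewrite g12 vfield0.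
have -> : e1 (metric g X e2) = 0 :> Cinfty G.
  by case: Xe => [|[]] ->; rewrite ?d2 ?g12 ?g32 ?vfield_cst ?vfield0.
have -> : e2 (metric g X e1) = 0 :> Cinfty G.
  by case: Xe => [|[]] ->; rewrite ?d1 ?g21 ?g31 ?vfield_cst ?vfield0.
rewrite !add0r oppr0 add0r E => K; apply: Cinfty_ext => p.
by have := congr1 (fun f : Cinfty G => f p) K; rewrite !evalE; lra.
Qed.

Lemma rotation_form1 : rotation_form e1 = 0.
Proof.
rewrite (@koszul_e1e2 _ 0) /smooth_cst ?scale0r //; first by left.
rewrite !brE (tensor0l (metric_tensor g)) !metricZl !gE.
by apply: Cinfty_ext => p; rewrite !evalE; lra.
Qed.

Lemma rotation_form2 : rotation_form e2 = 0.
Proof.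
rewrite (@koszul_e1e2 _ 0) /smooth_cst ?scale0r //; first by right; left.
rewrite !brE (tensor0l (metric_tensor g)) !metricZl !gE.
by apply: Cinfty_ext => p; rewrite !evalE; lra.
Qed.

Lemma rotation_form3 : rotation_form e3 = smooth_cst (2^-1 * (alpha + beta - gamma)).
Proof.
apply: koszul_e1e2; first by right; right.
rewrite !brE !metricZl !gE.
by apply: Cinfty_ext => p; rewrite !evalE; lra.
Qed.

Let dphi := dform (phi := rotation_form).
(** The value of dphi on (e1, e2): there dphi is -phi([e1, e2]), and
    [e1, e2] = - gamma e3. *)
Let c : R := gamma * (2^-1 * (alpha + beta - gamma)).

Let formZ f X : rotation_form (f *: X) = f * rotation_form X.
Proof. by rewrite /rotation_form (connZl cC) metricZl. Qed.

Let form0 : rotation_form 0 = 0.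
Proof. by rewrite /rotation_form (conn0l cC) (tensor0l (metric_tensor g)). Qed.

Let formE := (form0, formZ, rotation_form1, rotation_form2, rotation_form3).

(** The curvature maps e1 to a multiple of e2, so only the e2-term of the trace
    survives. *)
Lemma ricci_e1 X : ricci g C e1 e2 e3 X e1 = - dphi X e2.
Proof.
rewrite /ricci !(curvature_plane1 cC canonical_e1 canonical_e2) !metricZl !gE.
by rewrite !mulr0 mulr1 oppr0 add0r addr0.
Qed.

Lemma ricci_e2 X : ricci g C e1 e2 e3 X e2 = dphi X e1.
Proof.
rewrite /ricci !(curvature_plane2 cC canonical_e1 canonical_e2) !metricZl !gE.
by rewrite !mulr0 mulr1 opprK subr0 addr0.
Qed.

Lemma ricci_e3 X : ricci g C e1 e2 e3 X e3 = 0.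
Proof.
rewrite /ricci !(curvature_axis cC canonical_e3) !(tensor0l (metric_tensor g)).
by rewrite !(oppr0, addr0).
Qed.

(** On the frame dphi vanishes except on the pair e1, e2, so the Ricci form is - c
    times the metric of the plane spanned by e1 and e2, and that metric is the
    half-sum of g(X, Y) and g(X, JY). *)
Lemma ricci_canonical X Y :
  ricci g C e1 e2 e3 X Y = (- (2^-1 * c)) *: (metric g X Y + metric g X (J Y)).
Proof.
apply: (@eq_tensor_frame3 (ricci g C e1 e2 e3)
  (fun X Y => (- (2^-1 * c)) *: (metric g X Y + metric g X (J Y)))).
- exact: ricci_tensor.
- exact: parallel_form_tensor.
by apply: I3_ind; apply: I3_ind; rewrite !(tnth_nth 0) /= ?ricci_e1 ?ricci_e2 ?ricci_e3
  ?Je1 ?Je2 ?Je3 ?metricNr /dphi /dform ?brE !gE ?formE ?vfield_cst ?vfield0;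
  apply: Cinfty_ext => p; rewrite !evalE /c; lra.
Qed.

Lemma sym_ricci_canonical X Y : sym_ricci g C e1 e2 e3 X Y
  = (- (2^-1 * c)) *: (metric g X Y + metric g X (J Y)).
Proof.
rewrite /sym_ricci !ricci_canonical (metricC g Y X) (metricC g Y (J X)) J_selfadjoint.
by apply: Cinfty_ext => p; rewrite !evalE; lra.
Qed.

Lemma sym_ricci_codazzi : codazzi C (sym_ricci g C e1 e2 e3).
Proof.
have -> : sym_ricci g C e1 e2 e3 =
    fun X Y => (- (2^-1 * c)) *: (metric g X Y + metric g X (J Y)).
  by apply/funext => X; apply/funext => Y; exact: sym_ricci_canonical.
split; first exact: parallel_form_tensor.
by move=> X Y Z; rewrite !(canonical_parallel lc JJ J_selfadjoint) subrr.
Qed.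
End Frame3.

Theorem theorem4p10 (R : realType) (alpha beta gamma : R)
    (G : lieGroupType R 3) (g : pseudoRiemannian G) (e1 e2 e3 : vfield G)
    (nablaL : vfield G -> vfield G -> vfield G)
    (J : {linear vfield G -> vfield G})
    (G_connected : connected [set: G])
    (G_simply_connected : simply_connected R G)
    (g_lorentzian : lorentzian g)
    (g_left_invariant : left_invariant_metric g)
    (e_basis : lie_basis (tnth [tuple e1; e2; e3]))
    (g11 : metric g e1 e1 = 1) (g22 : metric g e2 e2 = 1)
    (g33 : metric g e3 e3 = -1)
    (g12 : metric g e1 e2 = 0) (g13 : metric g e1 e3 = 0)
    (g23 : metric g e2 e3 = 0)
    (br12 : bracket e1 e2 = smooth_cst (- gamma) *: e3)
    (br13 : bracket e1 e3 = smooth_cst (- beta) *: e2)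
    (br23 : bracket e2 e3 = smooth_cst alpha *: e1)
    (nablaL_levi_civita : levi_civita g nablaL)
    (J_product : product_structure J)
    (Je1 : J e1 = e1) (Je2 : J e2 = e2) (Je3 : J e3 = - e3) :
  codazzi (canonical_connection nablaL J)
    (sym_ricci g (canonical_connection nablaL J) e1 e2 e3).
Proof.
exact: (sym_ricci_codazzi e_basis g11 g22 g33 g12 g13 g23 br12 br13 br23
  nablaL_levi_civita J_product Je1 Je2 Je3).
Qed.
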